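(* Let $\mathcal A$ be a propointed finitely complete category, with initial object $0$. The following are equivalent. (1) $\mathcal A$ is protomodular. (2) The split short five lemma holds in $\mathcal A$, that is: for any left-exact sequences $(e\colon A\to 0,\ f\colon A\to B,\ g\colon B\to C)$ and $(e'\colon A'\to 0,\ f'\colon A'\to B',\ g'\colon B'\to C')$ in $\mathcal A$, any morphisms $s\colon C\to B$, $s'\colon C'\to B'$ with $g\circ s=\mathrm{id}_C$ and $g'\circ s'=\mathrm{id}_{C'}$, and any morphisms $\alpha\colon A\to A'$, $\beta\colon B\to B'$, $\gamma\colon C\to C'$ such that $e'\circ\alpha=e$, $\beta\circ f=f'\circ\alpha$, $\gamma\circ g=g'\circ\beta$ and $\beta\circ s=s'\circ\gamma$, if $\alpha$ and $\gamma$ are isomorphisms, then so is $\beta$.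
   Context: A finitely complete category is propointed if it admits an initial object $0$ and the unique morphism $0\to1$ is a universal extremal epimorphism (an extremal epimorphism all of whose pullbacks are extremal epimorphisms). Protomodular is meant in the sense of Bourn: a finitely complete category is protomodular if for every morphism $v\colon Y\to X$ the pullback functor from the category of points over $X$ (split epimorphisms with codomain $X$ together with a chosen section) to the category of points over $Y$ is conservative. In a category with an initial object $0$, a left-exact sequence is a triple of morphisms $(e\colon A\to0,\ f\colon A\to B,\ g\colon B\to C)$ such that the square $g\circ f=!_C\circ e$, where $!_C\colon 0\to C$ is the unique morphism, commutes and is a pullback. *)

(* Defs.v *)
From Stdlib Require Import List FinFun ProofIrrelevance ClassicalEpsilon.

Set Implicit Arguments.
Unset Strict Implicit.
Unset Printing Implicit Defensive.

Declare Scope cat_scope.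
Delimit Scope cat_scope with cat.

Record category := Category {
  obj :> Type;
  hom : obj -> obj -> Type;
  idm : forall x, hom x x;
  comp : forall x y z, hom y z -> hom x y -> hom x z;
  comp_id_l : forall x y (f : hom x y), comp (idm y) f = f;
  comp_id_r : forall x y (f : hom x y), comp f (idm x) = f;
  comp_assoc : forall w x y z (h : hom y z) (g : hom x y) (f : hom w x),
    comp h (comp g f) = comp (comp h g) f
}.

Arguments hom {c} x y.
Arguments idm {c} x.
Arguments comp {c x y z} g f : rename.

Notation "g ∘ f" := (comp g f) (at level 40, left associativity) : cat_scope.
Local Open Scope cat_scope.

Definition is_iso (C : category) (x y : C) (f : hom x y) : Prop :=
  exists g : hom y x, g ∘ f = idm x /\ f ∘ g = idm y.

Definition is_mono (C : category) (x y : C) (f : hom x y) : Prop :=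
  forall (w : C) (a b : hom w x), f ∘ a = f ∘ b -> a = b.

Definition is_epi (C : category) (x y : C) (f : hom x y) : Prop :=
  forall (z : C) (a b : hom y z), a ∘ f = b ∘ f -> a = b.

Definition is_extremal_epi (C : category) (x y : C) (f : hom x y) : Prop :=
  is_epi f /\
  forall (z : C) (m : hom z y) (g : hom x z), is_mono m -> f = m ∘ g -> is_iso m.

Record functor (C D : category) := Functor {
  fobj :> C -> D;
  fmap : forall x y, hom x y -> hom (fobj x) (fobj y);
  fmap_id : forall x, fmap (idm x) = idm (fobj x);
  fmap_comp : forall x y z (g : hom y z) (f : hom x y),
    fmap (g ∘ f) = fmap g ∘ fmap f
}.

Definition conservative (C D : category) (F : functor C D) : Prop :=
  forall (x y : C) (f : hom x y), is_iso (fmap F f) -> is_iso f.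

Record initial_object (C : category) := InitialObject {
  initial_obj :> C;
  from_initial : forall x : C, hom initial_obj x;
  from_initial_unique : forall (x : C) (f : hom initial_obj x), f = from_initial x
}.

Record terminal_object (C : category) := TerminalObject {
  terminal_obj :> C;
  to_terminal : forall x : C, hom x terminal_obj;
  to_terminal_unique : forall (x : C) (f : hom x terminal_obj), f = to_terminal x
}.

Record cone (J C : category) (F : functor J C) := Cone {
  apex : C;
  leg : forall j : J, hom apex (F j);
  leg_natural : forall (i j : J) (u : hom i j), fmap F u ∘ leg i = leg j
}.

Definition is_limit (J C : category) (F : functor J C) (K : cone F) : Prop :=
  forall K' : cone F,
    exists! u : hom (apex K') (apex K), forall j : J, leg K j ∘ u = leg K' j.

Definition finite_category (J : category) : Prop :=
  Finite J /\ forall i j : J, Finite (hom i j).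

Definition finitely_complete (C : category) : Prop :=
  forall (J : category) (F : functor J C), finite_category J ->
    exists K : cone F, is_limit K.

(*      p
    P -----> A
    |        |
  q |        | f
    v        v
    B -----> D
        g           *)
Definition is_pullback (C : category) (P A B D : C)
    (p : hom P A) (q : hom P B) (f : hom A D) (g : hom B D) : Prop :=
  f ∘ p = g ∘ q /\
  forall (Q : C) (a : hom Q A) (b : hom Q B), f ∘ a = g ∘ b ->
    exists! u : hom Q P, p ∘ u = a /\ q ∘ u = b.

Definition is_universal_extremal_epi (C : category) (x y : C) (f : hom x y) : Prop :=
  is_extremal_epi f /\
  forall (P z : C) (v : hom z y) (p : hom P x) (q : hom P z),
    is_pullback p q f v -> is_extremal_epi q.

Definition propointed (C : category) : Prop :=
  exists (Z : initial_object C) (T : terminal_object C),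
    is_universal_extremal_epi (from_initial Z T).

(* Pullbacks are limits over the finite category l -> m <- r. *)

Inductive cospan_obj : Set := cs_l | cs_m | cs_r.

Definition cospan_hom (i j : cospan_obj) : Set :=
  match i, j with
  | cs_l, cs_l | cs_m, cs_m | cs_r, cs_r | cs_l, cs_m | cs_r, cs_m => unit
  | _, _ => Empty_set
  end.

Definition cospan_id (i : cospan_obj) : cospan_hom i i :=
  match i with cs_l | cs_m | cs_r => tt end.

Definition cospan_comp (i j k : cospan_obj) :
  cospan_hom j k -> cospan_hom i j -> cospan_hom i k.
Proof. destruct i, j, k; simpl; intros g f; easy. Defined.

Lemma cospan_hom_eq (i j : cospan_obj) (f g : cospan_hom i j) : f = g.
Proof. destruct i, j, f, g; reflexivity. Qed.

Definition cospan : category :=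
  Category (obj := cospan_obj) (hom := cospan_hom)
    (idm := cospan_id) (comp := cospan_comp)
    (fun _ _ _ => cospan_hom_eq _ _) (fun _ _ _ => cospan_hom_eq _ _)
    (fun _ _ _ _ _ _ _ => cospan_hom_eq _ _).

Lemma cospan_finite : finite_category cospan.
Proof.
split.
- exists (cs_l :: cs_m :: cs_r :: nil); intros []; simpl; auto.
- intros [] []; simpl;
    first [ exists (tt :: nil); intros []; simpl; now left | now exists nil ].
Qed.

Section CospanDiagram.
Variables (C : category) (A B D : C) (f : hom A D) (g : hom B D).

Definition cospan_diagram_obj (i : cospan) : C :=
  match i with cs_l => A | cs_m => D | cs_r => B end.

Definition cospan_diagram_map (i j : cospan) :
  hom i j -> hom (cospan_diagram_obj i) (cospan_diagram_obj j) :=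
  match i, j return
    cospan_hom i j -> hom (cospan_diagram_obj i) (cospan_diagram_obj j) with
  | cs_l, cs_l => fun _ => idm A
  | cs_l, cs_m => fun _ => f
  | cs_l, cs_r => fun u => match u with end
  | cs_m, cs_l => fun u => match u with end
  | cs_m, cs_m => fun _ => idm D
  | cs_m, cs_r => fun u => match u with end
  | cs_r, cs_l => fun u => match u with end
  | cs_r, cs_m => fun _ => g
  | cs_r, cs_r => fun _ => idm B
  end.

Lemma cospan_diagram_id (i : cospan) :
  cospan_diagram_map (idm i) = idm (cospan_diagram_obj i).
Proof. now destruct i. Qed.

Lemma cospan_diagram_comp (i j k : cospan) (v : hom j k) (u : hom i j) :
  cospan_diagram_map (v ∘ u) = cospan_diagram_map v ∘ cospan_diagram_map u.
Proof.
destruct i, j, k; simpl in u, v; try easy; simpl;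
  now rewrite ?comp_id_l, ?comp_id_r.
Qed.

Definition cospan_diagram : functor cospan C :=
  Functor cospan_diagram_id cospan_diagram_comp.

Definition cospan_cone (Q : C) (a : hom Q A) (b : hom Q B)
    (H : f ∘ a = g ∘ b) : cone cospan_diagram.
Proof.
refine (@Cone _ _ cospan_diagram Q
  (fun i : cospan_obj => match i return hom Q (cospan_diagram_obj i) with
     cs_l => a | cs_m => f ∘ a | cs_r => b end) _).
intros [] [] u; simpl in u; try easy; simpl; now rewrite ?comp_id_l.
Defined.

End CospanDiagram.

Record pullback (C : category) (A B D : C) (f : hom A D) (g : hom B D) := Pullback {
  pb_obj :> C;
  pb_fst : hom pb_obj A;
  pb_snd : hom pb_obj B;
  pb_is_pullback : is_pullback pb_fst pb_snd f g
}.

Lemma pullback_exists (C : category) (hC : finitely_complete C)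
    (A B D : C) (f : hom A D) (g : hom B D) : inhabited (pullback f g).
Proof.
destruct (hC _ (cospan_diagram f g) cospan_finite) as [K HK].
constructor.
apply (@Pullback _ _ _ _ f g (apex K) (leg K (cs_l : cospan)) (leg K (cs_r : cospan))).
split.
- transitivity (leg K (cs_m : cospan)).
  + exact (leg_natural K (i := cs_l) (j := cs_m) tt).
  + symmetry; exact (leg_natural K (i := cs_r) (j := cs_m) tt).
- intros Q a b H.
  destruct (HK (cospan_cone H)) as [u [Hu Uu]].
  exists u; split.
  + split; [exact (Hu cs_l) | exact (Hu cs_r)].
  + intros v [Ha Hb]; apply Uu; intros []; simpl; auto.
    rewrite <- Ha, comp_assoc; f_equal.
    symmetry; exact (leg_natural K (i := cs_l) (j := cs_m) tt).
Qed.

Definition chosen_pullback (C : category) (hC : finitely_complete C)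
    (A B D : C) (f : hom A D) (g : hom B D) : pullback f g :=
  epsilon (pullback_exists hC f g) (fun _ => True).

Section PullbackLift.
Variables (C : category) (A B D : C) (f : hom A D) (g : hom B D) (P : pullback f g).

Lemma pb_square : f ∘ pb_fst P = g ∘ pb_snd P.
Proof. exact (proj1 (pb_is_pullback P)). Qed.

Lemma pb_lift_exists (Q : C) (a : hom Q A) (b : hom Q B) (H : f ∘ a = g ∘ b) :
  exists u : hom Q P, pb_fst P ∘ u = a /\ pb_snd P ∘ u = b.
Proof. destruct (proj2 (pb_is_pullback P) Q a b H) as [u [Hu _]]; eauto. Qed.

Definition pb_lift (Q : C) (a : hom Q A) (b : hom Q B) (H : f ∘ a = g ∘ b) : hom Q P :=
  proj1_sig (constructive_indefinite_description _ (pb_lift_exists H)).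

Lemma pb_lift_fst (Q : C) (a : hom Q A) (b : hom Q B) (H : f ∘ a = g ∘ b) :
  pb_fst P ∘ pb_lift H = a.
Proof. unfold pb_lift; destruct constructive_indefinite_description; simpl; tauto. Qed.

Lemma pb_lift_snd (Q : C) (a : hom Q A) (b : hom Q B) (H : f ∘ a = g ∘ b) :
  pb_snd P ∘ pb_lift H = b.
Proof. unfold pb_lift; destruct constructive_indefinite_description; simpl; tauto. Qed.

Lemma pb_hom_eq (Q : C) (u v : hom Q P) :
  pb_fst P ∘ u = pb_fst P ∘ v -> pb_snd P ∘ u = pb_snd P ∘ v -> u = v.
Proof.
intros H1 H2.
assert (H : f ∘ (pb_fst P ∘ v) = g ∘ (pb_snd P ∘ v))
  by now rewrite !comp_assoc, pb_square.
destruct (proj2 (pb_is_pullback P) Q _ _ H) as [w [_ Uw]].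
transitivity w; [symmetry |]; apply Uw; auto.
Qed.

End PullbackLift.

Record point (C : category) (X : C) := Point {
  pt_obj : C;
  pt_proj : hom pt_obj X;
  pt_sec : hom X pt_obj;
  pt_split : pt_proj ∘ pt_sec = idm X
}.

Definition point_hom (C : category) (X : C) (E E' : point X) : Type :=
  {f : hom (pt_obj E) (pt_obj E') |
     pt_proj E' ∘ f = pt_proj E /\ f ∘ pt_sec E = pt_sec E'}.

Lemma point_hom_eq (C : category) (X : C) (E E' : point X) (f g : point_hom E E') :
  proj1_sig f = proj1_sig g -> f = g.
Proof. apply eq_sig_hprop; intros; apply proof_irrelevance. Qed.

Definition point_id (C : category) (X : C) (E : point X) : point_hom E E :=
  exist _ (idm (pt_obj E)) (conj (comp_id_r _) (comp_id_l _)).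

Definition point_comp (C : category) (X : C) (E E' E'' : point X)
    (g : point_hom E' E'') (f : point_hom E E') : point_hom E E''.
Proof.
exists (proj1_sig g ∘ proj1_sig f).
destruct f as [f [Hf1 Hf2]], g as [g [Hg1 Hg2]]; simpl; split.
- now rewrite comp_assoc, Hg1.
- now rewrite <- comp_assoc, Hf2.
Defined.

Definition points (C : category) (X : C) : category.
Proof.
refine (@Category (point X) (@point_hom C X) (@point_id C X) (@point_comp C X) _ _ _);
  intros; apply point_hom_eq; simpl.
- apply comp_id_l.
- apply comp_id_r.
- apply comp_assoc.
Defined.

Section PullbackFunctor.
Variables (C : category) (hC : finitely_complete C) (Y X : C) (v : hom Y X).

Lemma pullback_point_sec_square (E : point X) :
  pt_proj E ∘ (pt_sec E ∘ v) = v ∘ idm Y.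
Proof. now rewrite comp_assoc, pt_split, comp_id_l, comp_id_r. Qed.

Definition pullback_point (E : points X) : points Y :=
  let P := chosen_pullback hC (pt_proj E) v in
  {| pt_obj := P;
     pt_proj := pb_snd P;
     pt_sec := pb_lift P (pullback_point_sec_square E);
     pt_split := pb_lift_snd P (pullback_point_sec_square E) |}.

Lemma pullback_point_map_square (E E' : points X) (f : hom E E') :
  let P := chosen_pullback hC (pt_proj E) v in
  pt_proj E' ∘ (proj1_sig f ∘ pb_fst P) = v ∘ pb_snd P.
Proof.
simpl; rewrite comp_assoc, (proj1 (proj2_sig f)); apply pb_square.
Qed.

Definition pullback_point_map (E E' : points X) (f : hom E E') :
  hom (pullback_point E) (pullback_point E').
Proof.
exists (pb_lift (chosen_pullback hC (pt_proj E') v) (pullback_point_map_square f)).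
split; simpl.
- apply pb_lift_snd.
- apply pb_hom_eq.
  + rewrite comp_assoc, !pb_lift_fst, <- comp_assoc, pb_lift_fst, comp_assoc.
    now rewrite (proj2 (proj2_sig f)).
  + now rewrite comp_assoc, !pb_lift_snd.
Defined.

Definition pullback_functor : functor (points X) (points Y).
Proof.
refine (@Functor (points X) (points Y) pullback_point pullback_point_map _ _).
- intros E; apply point_hom_eq; apply pb_hom_eq; simpl.
  + now rewrite pb_lift_fst, comp_id_l, comp_id_r.
  + now rewrite pb_lift_snd, comp_id_r.
- intros E E' E'' g f; apply point_hom_eq; apply pb_hom_eq; simpl.
  + now rewrite comp_assoc, !pb_lift_fst, <- !comp_assoc, pb_lift_fst.
  + now rewrite comp_assoc, !pb_lift_snd.
Defined.

End PullbackFunctor.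

Definition protomodular (C : category) (hC : finitely_complete C) : Prop :=
  forall (Y X : C) (v : hom Y X), conservative (pullback_functor hC v).

Definition left_exact (C : category) (Z : initial_object C) (A B D : C)
    (e : hom A Z) (f : hom A B) (g : hom B D) : Prop :=
  is_pullback f e g (from_initial Z D).

Definition split_short_five_lemma (U : category) (Z : initial_object U) : Prop :=
  forall (A B C A' B' C' : U)
    (e : hom A Z) (f : hom A B) (g : hom B C)
    (e' : hom A' Z) (f' : hom A' B') (g' : hom B' C'),
    left_exact e f g -> left_exact e' f' g' ->
  forall (s : hom C B) (s' : hom C' B'),
    g ∘ s = idm C -> g' ∘ s' = idm C' ->
  forall (alpha : hom A A') (beta : hom B B') (gamma : hom C C'),
    e' ∘ alpha = e ->
    beta ∘ f = f' ∘ alpha ->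
    gamma ∘ g = g' ∘ beta ->
    beta ∘ s = s' ∘ gamma ->
    is_iso alpha -> is_iso gamma -> is_iso beta.

(* Main.v *)
Require Import Defs.

(** The kernel of a point over [X] is its pullback along [0 -> X].  The split
    short five lemma is, up to transport along the isomorphism [gamma],
    conservativity of these particular pullback functors; and conservativity
    along an arbitrary [v : Y -> X] reduces to it because [0 -> X] factors as
    [0 -> Y -> X]. *)

Set Implicit Arguments.
Unset Strict Implicit.
Unset Printing Implicit Defensive.

Local Open Scope cat_scope.

Lemma is_iso_id (C : category) (x : C) : is_iso (idm x).
Proof. exists (idm x); split; apply comp_id_l. Qed.

Lemma is_iso_comp (C : category) (x y z : C) (g : hom y z) (f : hom x y) :
  is_iso g -> is_iso f -> is_iso (g ∘ f).
Proof.
intros [g' [Hg1 Hg2]] [f' [Hf1 Hf2]]; exists (f' ∘ g'); split.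
- now rewrite <- comp_assoc, (comp_assoc g'), Hg1, comp_id_l.
- now rewrite <- comp_assoc, (comp_assoc f), Hf2, comp_id_l.
Qed.

Lemma is_iso_cancel_l (C : category) (x y z : C) (g : hom y z) (f : hom x y) :
  is_iso g -> is_iso (g ∘ f) -> is_iso f.
Proof.
intros [g' [Hg1 Hg2]] Hgf.
replace f with (g' ∘ (g ∘ f)) by now rewrite comp_assoc, Hg1, comp_id_l.
apply is_iso_comp; [exists g; auto | exact Hgf].
Qed.

Lemma is_iso_mono (C : category) (x y : C) (f : hom x y) : is_iso f -> is_mono f.
Proof.
intros [g [Hg _]] w a b H.
now rewrite <- (comp_id_l a), <- (comp_id_l b), <- Hg, <- !comp_assoc, H.
Qed.

Lemma fmap_is_iso (C D : category) (F : functor C D) (x y : C) (f : hom x y) :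
  is_iso f -> is_iso (fmap F f).
Proof.
intros [g [H1 H2]]; exists (fmap F g).
now rewrite <- !fmap_comp, H1, H2, !fmap_id.
Qed.

(** The inverse of the underlying morphism automatically respects projections and sections: compose
    each compatibility of [f] with that inverse. *)
Lemma point_iso_iff (C : category) (X : C) (E E' : points X) (f : hom E E') :
  is_iso f <-> is_iso (proj1_sig f).
Proof.
split.
- intros [g [H1 H2]]; exists (proj1_sig g); split;
    [exact (f_equal (@proj1_sig _ _) H1) | exact (f_equal (@proj1_sig _ _) H2)].
- intros [g [H1 H2]].
  destruct f as [f [Hp Hs]]; simpl in *.
  assert (Hg : pt_proj E ∘ g = pt_proj E' /\ g ∘ pt_sec E' = pt_sec E).
  { split.
    - now rewrite <- Hp, <- comp_assoc, H2, comp_id_r.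
    - now rewrite <- Hs, comp_assoc, H1, comp_id_l. }
  exists (exist _ g Hg); split; apply point_hom_eq; assumption.
Qed.

Section Pullbacks.
Variable C : category.

Lemma is_pullback_hom_eq (P A B D : C) (p : hom P A) (q : hom P B)
    (f : hom A D) (g : hom B D) (Q : C) (u v : hom Q P) :
  is_pullback p q f g -> p ∘ u = p ∘ v -> q ∘ u = q ∘ v -> u = v.
Proof.
intros HP; exact (@pb_hom_eq _ _ _ _ _ _ (Pullback HP) Q u v).
Qed.

Lemma is_pullback_comparison (P P' A B D : C) (p : hom P A) (q : hom P B)
    (p' : hom P' A) (q' : hom P' B) (f : hom A D) (g : hom B D) :
  is_pullback p q f g -> is_pullback p' q' f g ->
  exists u : hom P P', is_iso u /\ p' ∘ u = p /\ q' ∘ u = q.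
Proof.
intros HP HP'.
destruct (proj2 HP' _ _ _ (proj1 HP)) as [u [[Hu1 Hu2] _]].
destruct (proj2 HP _ _ _ (proj1 HP')) as [w [[Hw1 Hw2] _]].
exists u; split; [| auto].
exists w; split.
- apply (is_pullback_hom_eq HP); rewrite comp_assoc, comp_id_r; congruence.
- apply (is_pullback_hom_eq HP'); rewrite comp_assoc, comp_id_r; congruence.
Qed.

(** Cancelling [m] shows that both cospans have the same commuting squares over them. This lets a
    kernel survive a change of base along an isomorphism. *)
Lemma is_pullback_mono (P A B D D' : C) (p : hom P A) (q : hom P B)
    (f : hom A D) (g : hom B D) (m : hom D D') :
  is_mono m -> is_pullback p q f g -> is_pullback p q (m ∘ f) (m ∘ g).
Proof.
intros Hm [Hs Hu]; split.
- now rewrite <- !comp_assoc, Hs.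
- intros Q a b H; apply Hu, Hm; now rewrite !comp_assoc.
Qed.

Lemma is_pullback_paste (Q P A B B' D : C) (p : hom P A) (q : hom P B)
    (f : hom A D) (g : hom B D) (p' : hom Q P) (q' : hom Q B') (g' : hom B' B) :
  is_pullback p q f g -> is_pullback p' q' q g' ->
  is_pullback (p ∘ p') q' f (g ∘ g').
Proof.
intros HP HQ; split.
- now rewrite comp_assoc, (proj1 HP), <- !comp_assoc, (proj1 HQ).
- intros R a b H.
  rewrite <- comp_assoc in H.
  destruct (proj2 HP _ _ _ H) as [w [[Hw1 Hw2] _]].
  destruct (proj2 HQ _ _ _ Hw2) as [u [[Hu1 Hu2] _]].
  exists u; split.
  + split; [now rewrite <- comp_assoc, Hu1 | exact Hu2].
  + intros u' [H1 H2].
    apply (is_pullback_hom_eq HQ); [| congruence].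
    apply (is_pullback_hom_eq HP).
    * rewrite Hu1, Hw1, comp_assoc; congruence.
    * now rewrite !comp_assoc, (proj1 HQ), <- !comp_assoc, Hu2, H2.
Qed.

(** Here [m] and [n] are the maps induced by [beta] for two choices of the pullbacks, so they differ
    only by the comparison isomorphisms. This frees arguments from the chosen pullbacks. *)
Lemma is_pullback_map_iso (P Q P' Q' A A' B D D' : C)
    (f : hom A D) (g : hom B D) (f' : hom A' D') (g' : hom B D')
    (p : hom P A) (q : hom P B) (a : hom Q A) (b : hom Q B)
    (p' : hom P' A') (q' : hom P' B) (a' : hom Q' A') (b' : hom Q' B)
    (beta : hom A A') (m : hom P P') (n : hom Q Q') :
  is_pullback p q f g -> is_pullback a b f g ->
  is_pullback p' q' f' g' -> is_pullback a' b' f' g' ->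
  p' ∘ m = beta ∘ p -> q' ∘ m = q ->
  a' ∘ n = beta ∘ a -> b' ∘ n = b ->
  is_iso n -> is_iso m.
Proof.
intros HP HQ HP' HQ' Hm1 Hm2 Hn1 Hn2 Hn.
destruct (is_pullback_comparison HP HQ) as [u [Hu [Hu1 Hu2]]].
destruct (is_pullback_comparison HP' HQ') as [w [Hw [Hw1 Hw2]]].
apply (is_iso_cancel_l Hw).
(* Both composites have components [beta ∘ p] along [a'] and [q] along [b']. *)
replace (w ∘ m) with (n ∘ u); [now apply is_iso_comp |].
apply (is_pullback_hom_eq HQ'); rewrite !comp_assoc.
- now rewrite Hn1, Hw1, Hm1, <- comp_assoc, Hu1.
- now rewrite Hn2, Hw2, Hm2.
Qed.

End Pullbacks.

Lemma comp_from_initial (C : category) (Z : initial_object C) (x y : C) (v : hom x y) :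
  v ∘ from_initial Z x = from_initial Z y.
Proof. apply from_initial_unique. Qed.

Lemma protomodular_split_short_five (A : category) (hA : finitely_complete A)
    (Z : initial_object A) :
  protomodular hA -> split_short_five_lemma Z.
Proof.
intros hP K B C K' B' C' e f g e' f' g' HK HK' s s' Hs Hs'
  alpha beta gamma He Hf Hg Hbs Halpha Hgamma.
destruct Hgamma as [delta [Hd1 Hd2]].
assert (Hgamma : is_iso gamma) by now exists delta.
(* Transporting the point on [B] along [gamma] makes [beta] a morphism of points over the single
   base [C']. *)
assert (HE : (gamma ∘ g) ∘ (s ∘ delta) = idm C').
{ now rewrite <- comp_assoc, (comp_assoc g), Hs, comp_id_l. }
pose (E := Point HE : points C').
pose (E' := Point Hs' : points C').
assert (Hbeta : pt_proj E' ∘ beta = pt_proj E /\ beta ∘ pt_sec E = pt_sec E').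
{ simpl; split; [auto |].
  now rewrite comp_assoc, Hbs, <- comp_assoc, Hd2, comp_id_r. }
pose (b := exist _ beta Hbeta : hom E E').
enough (Hb : is_iso b) by exact (proj1 (point_iso_iff b) Hb).
apply (hP _ _ (from_initial Z C')), point_iso_iff; simpl.
(* Since [gamma] is monic, [K] is still the kernel after transport; hence [beta] restricts to
   [alpha] on kernels. *)
assert (HKE : is_pullback f e (pt_proj E) (from_initial Z C')).
{ rewrite <- (comp_from_initial Z gamma).
  now apply is_pullback_mono; [apply is_iso_mono |]. }
apply (is_pullback_map_iso (beta := beta) (n := alpha)
  (pb_is_pullback _) HKE (pb_is_pullback _) HK').
- apply pb_lift_fst.
- apply pb_lift_snd.
- now symmetry.
- exact He.
- exact Halpha.
Qed.

Lemma split_short_five_protomodular (A : category) (hA : finitely_complete A)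
    (Z : initial_object A) :
  split_short_five_lemma Z -> protomodular hA.
Proof.
intros hS Y X v E E' f Hf.
pose (zY := from_initial Z Y).
(* [k] is the restriction of [f] to the kernels of the points pulled back to [Y]; functors preserve
   isomorphisms, so it is invertible. *)
pose (k := fmap (pullback_functor hA zY) (fmap (pullback_functor hA v) f)).
assert (Hk : is_iso (proj1_sig k)) by now apply point_iso_iff, fmap_is_iso.
(* By pasting, the kernel of the pulled back point is also a kernel of [F] itself, because
   [0 -> Y -> X] is the unique map [0 -> X]. *)
assert (HK : forall F : points X,
  let P := chosen_pullback hA (pt_proj F) v in
  let Q := chosen_pullback hA (pb_snd P) zY in
  left_exact (pb_snd Q) (pb_fst P ∘ pb_fst Q) (pt_proj F)).
{ intros F P Q; unfold left_exact.
  rewrite <- (comp_from_initial Z v).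
  exact (is_pullback_paste (pb_is_pullback P) (pb_is_pullback Q)). }
apply point_iso_iff.
(* The lemma applies with [k] on kernels, [f] in the middle and the identity on the common base
   [X]. *)
apply (hS _ _ _ _ _ _ _ _ _ _ _ _ (HK E) (HK E') (pt_sec E) (pt_sec E')
  (pt_split E) (pt_split E') (proj1_sig k) (proj1_sig f) (idm X)).
- apply pb_lift_snd.
- simpl.
  rewrite <- (comp_assoc _ _ (pb_lift _ _)), pb_lift_fst.
  now rewrite (comp_assoc _ (pb_lift _ _)), pb_lift_fst, comp_assoc.
- rewrite comp_id_l; symmetry; exact (proj1 (proj2_sig f)).
- rewrite comp_id_r; exact (proj2 (proj2_sig f)).
- exact Hk.
- apply is_iso_id.
Qed.

Theorem theorem4p5 (A : category) (hA : finitely_complete A) (hp : propointed A)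
    (Z : initial_object A) :
  protomodular hA <-> split_short_five_lemma Z.
Proof.
split.
- apply protomodular_split_short_five.
- apply split_short_five_protomodular.
Qed.
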